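(* Let $T$ be a tree. Then $\gamma(F) = \gamma_e(F)$ for every induced subgraph $F$ of $T$ if and only if $T$ is $\{P_7, F_1\}$-free.
   Context: All graphs are finite, simple, and undirected. For a set $\mathcal{F}$ of graphs, a graph $G$ is $\mathcal{F}$-free if no induced subgraph of $G$ is isomorphic to a member of $\mathcal{F}$. Domination. A set $D$ of vertices of a graph $G$ is a dominating set of $G$ if every vertex of $G$ not in $D$ has a neighbor in $D$. The domination number $\gamma(G)$ is the minimum order of a dominating set of $G$. Exponential domination. Let $D$ be a set of vertices of a graph $G$. For two (not necessarily distinct) vertices $u,v$ of $G$, let $\mathrm{dist}_{(G,D)}(u,v)$ be the minimum length (number of edges) of a path $P$ in $G$ between $u$ and $v$ such that $D$ contains exactly one endvertex of $P$ but no internal vertex of $P$; if no such path exists, $\mathrm{dist}_{(G,D)}(u,v)=\infty$. In particular, if $u$ and $v$ are distinct vertices in $D$, then $\mathrm{dist}_{(G,D)}(u,u)=0$ and $\mathrm{dist}_{(G,D)}(u,v)=\infty$. For a vertex $u$ of $G$ let $$w_{(G,D)}(u)=\sum_{v\in D}\left(\tfrac12\right)^{\mathrm{dist}_{(G,D)}(u,v)-1},$$ where $\left(\tfrac12\right)^{\infty}=0$ (so $w_{(G,D)}(u)=2$ for $u\in D$). The set $D$ is an exponential dominating set of $G$ if $w_{(G,D)}(u)\ge 1$ for every vertex $u$ of $G$. The exponential domination number $\gamma_e(G)$ is the minimum order of an exponential dominating set of $G$. Specific graphs. $P_7$ is the path of order $7$ (seven vertices). $F_1$ is the graph with vertices $a,b,c,a',b',c'$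 and edges $ab, bc, aa', bb', cc'$ (a path on three vertices with one pendant vertex attached to each of its vertices). *)

(* Defs.v *)
From HB Require Import structures.
From mathcomp Require Import all_boot all_order all_algebra.
Set Implicit Arguments.
Unset Strict Implicit.
Unset Printing Implicit Defensive.
Import Order.TTheory GRing.Theory Num.Theory.

Record sgraph := SGraph {
  vertex :> finType;
  adj : rel vertex;
  adj_sym : symmetric adj;
  adj_irr : irreflexive adj }.

Definition isomorphic (G H : sgraph) : Prop :=
  exists2 f : G -> H, bijective f & forall x y, adj (f x) (f y) = adj x y.

Section Induced.
Variables (G : sgraph) (S : {set G}).

Definition ind_adj : rel {x : G | x \in S} := fun x y => adj (val x) (val y).

Lemma ind_adj_sym : symmetric ind_adj.
Proof. by move=> x y; rewrite /ind_adj adj_sym. Qed.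

Lemma ind_adj_irr : irreflexive ind_adj.
Proof. by move=> x; rewrite /ind_adj adj_irr. Qed.

Definition induced : sgraph := SGraph ind_adj_sym ind_adj_irr.
End Induced.

Definition free_of (F : sgraph -> Prop) (G : sgraph) : Prop :=
  forall H, F H -> forall S : {set G}, ~ isomorphic (induced S) H.

Definition connected (G : sgraph) : Prop :=
  0 < #|G| /\ forall x y : G, connect (@adj G) x y.

(* The bound on the size is needed because an edge traversed back and forth is
   a [cycle] of size 2 in the sense of path.v. *)
Definition acyclic (G : sgraph) : Prop :=
  forall c : seq G, cycle (@adj G) c -> uniq c -> size c < 3.

Definition is_tree (G : sgraph) : Prop := connected G /\ acyclic G.

Section EdgeList.
Variables (n : nat) (es : seq (nat * nat)).

Definition edge_list_adj : rel 'I_n := fun i j =>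
  (i != j) && (((i : nat, j : nat) \in es) || ((j : nat, i : nat) \in es)).

Lemma edge_list_adj_sym : symmetric edge_list_adj.
Proof. by move=> i j; rewrite /edge_list_adj eq_sym orbC. Qed.

Lemma edge_list_adj_irr : irreflexive edge_list_adj.
Proof. by move=> i; rewrite /edge_list_adj eqxx. Qed.

Definition graph_of_edges : sgraph :=
  SGraph edge_list_adj_sym edge_list_adj_irr.
End EdgeList.

Definition path_graph (n : nat) : sgraph :=
  graph_of_edges n [seq (i, i.+1) | i <- iota 0 n.-1].

Definition P7 : sgraph := path_graph 7.

(* a, b, c, a', b', c' are numbered 0, 1, 2, 3, 4, 5. *)
Definition F1 : sgraph :=
  graph_of_edges 6 [:: (0, 1); (1, 2); (0, 3); (1, 4); (2, 5)].

Section Domination.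
Variable G : sgraph.
Implicit Types (D : {set G}) (u v : G) (p : seq G).

Definition dominating D : bool :=
  [forall u, (u \notin D) ==> [exists v in D, adj u v]].

Lemma dominatingT : dominating [set: G].
Proof. by apply/forallP=> u; rewrite inE. Qed.

Definition gamma : nat := #|[arg min_(D < [set: G] | dominating D) #|D| ]|.

(* [u :: p] is the vertex sequence of a path from u to v whose length is
   [size p]; its internal vertices are [behead (belast u p)].  For u = v the
   path is trivial (p = [::]) and has the single endvertex u. *)
Definition Dpath D u v p : bool :=
  [&& path (@adj G) u p, uniq (u :: p), last u p == v,
      #|[set u; v] :&: D| == 1 & all [predC D] (behead (belast u p))].

(* None stands for infinity.  Since paths have no repeated vertex, their
   lengths are less than #|G|, so the search below is exhaustive; see [distDP]. *)
Definition distD D u v : option nat :=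
  ohead [seq n <- iota 0 #|G| | [exists p : n.-tuple G, Dpath D u v p]].

Lemma distDP D u v :
  match distD D u v with
  | Some n => (exists2 p, Dpath D u v p & size p = n) /\
              (forall p, Dpath D u v p -> n <= size p)
  | None => forall p, ~ Dpath D u v p
  end.
Proof.
rewrite /distD; set a := fun n => [exists p : n.-tuple G, Dpath D u v p].
have aP p : Dpath D u v p -> size p \in filter a (iota 0 #|G|).
  move=> Pp; rewrite mem_filter mem_iota leq0n add0n; apply/andP; split.
    by apply/existsP; exists (in_tuple p).
  case/and5P: Pp => _ Up _ _ _.
  by rewrite -[(size p).+1]/(size (u :: p)) -(card_uniqP Up) max_card.
have : sorted leq (filter a (iota 0 #|G|)).
  by apply: sorted_filter (iota_sorted _ _); apply: leq_trans.
have : all a (filter a (iota 0 #|G|)) by apply: filter_all.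
case: filter aP => [|n s] /= aP; first by move=> _ _ p /aP.
case/andP=> /existsP[p Pp] _ s_n; split; first by exists p; rewrite ?size_tuple.
move=> q /aP; rewrite inE => /predU1P[->//|]; apply/allP.
exact: (order_path_min leq_trans s_n).
Qed.

Local Open Scope ring_scope.

Definition half_pow (d : option nat) : rat :=
  if d is Some n then (1 / 2) ^ (n%:Z - 1) else 0.

Definition weight D u : rat := \sum_(v in D) half_pow (distD D u v).

Definition exp_dominating D : bool := [forall u, 1 <= weight D u].

Lemma half_pow_ge0 d : 0 <= half_pow d.
Proof. by case: d => //= n; apply: exprz_ge0. Qed.

Lemma distD_self D u : u \in D -> distD D u u = Some 0%N.
Proof.
move=> uD; have Pu : Dpath D u u [::].
  by rewrite /Dpath /= eqxx setUid (setIidPl _) ?sub1set// cards1.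
have := distDP D u u; case: distD => [n [_ /(_ _ Pu)]|/(_ _ Pu)//].
by rewrite leqn0 => /eqP->.
Qed.

Lemma exp_dominatingT : exp_dominating [set: G].
Proof.
apply/forallP=> u; rewrite /weight (bigD1 u) ?inE//= distD_self ?inE//.
by apply: ler_wpDr => //; apply: sumr_ge0 => v _; apply: half_pow_ge0.
Qed.

Definition gamma_e : nat :=
  #|[arg min_(D < [set: G] | exp_dominating D) #|D|%N]|.
End Domination.

(* Main.v *)
Require Import Defs.
From HB Require Import structures.
From mathcomp Require Import all_boot all_order all_algebra.

(** In one direction, both [P7] and [F1] have three vertices no two of which
    share a dominator, so that [gamma] is at least 3, and two vertices that
    exponentially dominate: the second and the sixth vertex of [P7], the two
    ends of the central path of [F1].  Every vertex far from both of them is at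
    distance 2 from each and collects 1/2 twice.  This is [gap_witness_iso].

    Conversely, [gamma_e G <= gamma G] holds in every graph, since a dominator
    contributes at least 1 to the weight.  For the other inequality, the
    essential point is that in a forest without a copy of [P7] or [F1] every
    component is dominated by two vertices ([two_vertices_dominate]): take a
    longest path of the component; it has at most six vertices, and its second
    and its second to last vertex dominate everything.  Indeed, branches off
    these two have depth 1 by maximality, and if there are further inner
    vertices they have no neighbour off the path, as a branch at the third
    vertex of a path with at least five would complete a copy of [F1].  On
    the other hand, weight does not cross components, and a single vertex
    gives weight at least 1 to its closed neighbourhood only.  Hence a
    component that contains a single vertex of an exponential dominating set is
    dominated by that vertex, and in a component that contains more of them,
    they can be replaced by two dominating vertices
    ([component_domination]).  Doing so in all components turns an exponential
    dominating set into a dominating set that is not larger.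

    In an acyclic graph, copies of a connected graph as a subgraph and as an
    induced subgraph are the same thing ([copy_induced]), so that the argument
    only has to produce edges, never non-edges. *)

Set Implicit Arguments.
Unset Strict Implicit.
Unset Printing Implicit Defensive.
Import Order.TTheory GRing.Theory Num.Theory.

(** * Copies in acyclic graphs *)

(** Copies need not be induced: this form passes from an induced subgraph to the
    whole graph and is the easiest to produce. *)
Definition has_copy (H G : sgraph) : Prop :=
  exists2 g : H -> G, injective g & forall x y, adj x y -> adj (g x) (g y).

(** An edge from [x] to a later vertex [w] of the path would close a cycle with
    the part of the path up to [w], unless that part is the first edge. *)
Lemma acyclic_chordless (G : sgraph) (x w : G) p : acyclic G ->
  path (@adj G) x p -> uniq (x :: p) -> w \in p -> adj x w -> ohead p = Some w.
Proof.
move=> acG + + w_p; case/splitPr: w_p => [[|y p1] p2] //= xP xU xw.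
have {xP}/andP[xy yP] : adj x y && path (@adj G) y (rcons p1 w).
  by move: xP; rewrite -cat_rcons cat_path => /and3P[-> ->].
have cP : cycle (@adj G) (x :: y :: rcons p1 w).
  by rewrite /= rcons_path last_rcons xy yP adj_sym.
have cU : uniq (x :: y :: rcons p1 w).
  have : uniq ((x :: y :: rcons p1 w) ++ p2) by rewrite /= cat_rcons.
  by rewrite cat_uniq => /andP[].
by have := acG _ cP cU; rewrite /= size_rcons.
Qed.

(** If [g x] and [g y] are adjacent, the image of a path from [x] to [y] has no
    chord, hence is a single edge. *)
Lemma copy_induced (H G : sgraph) (g : H -> G) : connected H -> acyclic G ->
  injective g -> (forall x y, adj x y -> adj (g x) (g y)) ->
  forall x y, adj (g x) (g y) = adj x y.
Proof.
move=> [_ connH] acG g_inj g_adj x y; apply/idP/idP=> [gxy|]; last exact: g_adj.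
have /connectP[q /shortenP[p xP xU _] def_y] := connH x y.
have gxP : path (@adj G) (g x) (map g p).
  by rewrite path_map; apply: sub_path xP => u v; apply: g_adj.
have gxU : uniq (g x :: map g p) by rewrite -map_cons map_inj_uniq.
have p_n0 : y \in p.
  case: p def_y {xP xU gxP gxU} => [|z p] /= def_y; last first.
    by rewrite def_y mem_last.
  by rewrite def_y adj_irr in gxy.
have := acyclic_chordless acG gxP gxU (map_f g p_n0) gxy.
by case: p xP {xU gxP gxU p_n0 def_y} => [|z p] //= /andP[xz _] [/g_inj <-].
Qed.

Lemma isomorphic_image (H G : sgraph) (g : H -> G) : injective g ->
  (forall x y, adj (g x) (g y) = adj x y) ->
  isomorphic (induced [set g x | x : H]) H.
Proof.
move=> g_inj g_adj.
pose h x : induced [set g x | x : H] := exist _ (g x) (imset_f g isT).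
have h_inj : injective h by move=> x y [/g_inj].
have [|f hK fK] := inj_card_bij h_inj.
  by rewrite card_sig -(card_imset _ g_inj); apply: eq_leq; apply: eq_card.
by exists f => [|u v]; [exists h | rewrite -{2}[u]fK -{2}[v]fK -g_adj].
Qed.

Lemma no_copy (F : sgraph -> Prop) (T H : sgraph) : acyclic T -> connected H ->
  F H -> free_of F T -> ~ has_copy H T.
Proof.
move=> acT connH FH freeT [g g_inj g_adj].
have := isomorphic_image g_inj (copy_induced connH acT g_inj g_adj).
exact: freeT.
Qed.

Lemma has_copy_induced (H G : sgraph) (S : {set G}) :
  has_copy H (induced S) -> has_copy H G.
Proof.
by move=> [g g_inj g_adj]; exists (val \o g) => // x y /val_inj/g_inj.
Qed.

Lemma acyclic_induced (G : sgraph) (S : {set G}) :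
  acyclic G -> acyclic (induced S).
Proof.
move=> acG c c_cyc c_uniq; rewrite -(size_map val); apply: acG.
  by case: c c_cyc {c_uniq} => //= x p; rewrite -map_rcons path_map.
by rewrite map_inj_uniq //; apply: val_inj.
Qed.

Lemma copy_of_edge_list (G : sgraph) (x0 : G) (s : seq G) n es :
  uniq s -> size s = n ->
  all (fun e => adj (nth x0 s e.1) (nth x0 s e.2)) es ->
  has_copy (graph_of_edges n es) G.
Proof.
move=> s_uniq s_size /allP es_adj; exists (fun i : 'I_n => nth x0 s i).
  by move=> i j /eqP; rewrite nth_uniq ?s_size // => /eqP/val_inj.
by move=> i j /andP[_ /orP[]/es_adj]//=; rewrite adj_sym.
Qed.

Lemma connected_from (G : sgraph) (x0 : G) :
  (forall x, connect (@adj G) x0 x) -> connected G.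
Proof.
move=> conn0; split=> [|x y]; first by apply/card_gt0P; exists x0.
apply: connect_trans (conn0 y).
by rewrite (sym_connect_sym (@adj_sym G)).
Qed.

(** * Domination and exponential domination *)

Definition dominates (G : sgraph) (v u : G) : bool := (u == v) || adj u v.

Section Domination.
Variable G : sgraph.
Implicit Types (D : {set G}) (u v : G).

Lemma dominatingP D :
  reflect (forall u, exists2 v, v \in D & dominates v u) (dominating D).
Proof.
apply: (iffP forallP) => [domD u | domD u].
  have [uD | uND] := boolP (u \in D).
    by exists u; rewrite // /dominates eqxx.
  have /implyP/(_ uND)/exists_inP[v vD uv] := domD u.
  by exists v; rewrite // /dominates uv orbT.
apply/implyP=> uND; apply/exists_inP; have [v vD /predU1P[def_v|uv]] := domD u.
  by rewrite def_v vD in uND.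
by exists v.
Qed.

Lemma gamma_min D : dominating D -> gamma G <= #|D|.
Proof.
by rewrite /gamma; case: arg_minnP => [|E _]; [exact: dominatingT | apply].
Qed.

Lemma gamma_witness : exists2 D : {set G}, dominating D & #|D| = gamma G.
Proof.
by rewrite /gamma; case: arg_minnP => [|E]; [exact: dominatingT | exists E].
Qed.

Lemma gamma_e_min D : exp_dominating D -> gamma_e G <= #|D|.
Proof.
rewrite /gamma_e.
by case: arg_minnP => [|E _]; [exact: exp_dominatingT | apply].
Qed.

Lemma gamma_e_witness :
  exists2 D : {set G}, exp_dominating D & #|D| = gamma_e G.
Proof.
rewrite /gamma_e.
by case: arg_minnP => [|E]; [exact: exp_dominatingT | exists E].
Qed.

Lemma half_powE n : half_pow (Some n) = (2 * (1 / 2) ^+ n)%R.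
Proof. by rewrite /half_pow addrC expfzDr. Qed.

Lemma half_pow_anti m n :
  m <= n -> (half_pow (Some n) <= half_pow (Some m))%R.
Proof. by move=> le_mn; rewrite !half_powE ler_wpM2l // ler_wiXn2l. Qed.

Lemma Dpath_weight D u v p :
  Dpath D u v p -> (half_pow (Some (size p)) <= half_pow (distD D u v))%R.
Proof.
move=> Pp; have := distDP D u v.
case: (distD D u v) => [n [_ min_n]|/(_ _ Pp)//].
exact/half_pow_anti/min_n.
Qed.

(** A contribution of at least 1 means distance at most 1, for at distance 2 the
    contribution is already 1/2. *)
Lemma half_pow_dist_dominates D u v :
  (1 <= half_pow (distD D u v))%R -> dominates v u.
Proof.
have := distDP D u v; case: (distD D u v) => [n [[p Pp <-] _]|_] //.
case: p Pp => [|y [|z p]] /and5P[/= up _ /eqP def_v _ _].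
- by move=> _; rewrite /dominates def_v eqxx.
- by move=> _; rewrite /dominates -def_v; rewrite andbT in up; rewrite up orbT.
by move/le_trans/(_ (half_pow_anti (isT : 2 <= (size p).+2))).
Qed.

Lemma half_pow_dist_connect D u v :
  ~~ connect (@adj G) u v -> half_pow (distD D u v) = 0%R.
Proof.
have := distDP D u v; case: (distD D u v) => [n [[p Pp _] _]|_] //.
by case/negP; case/and5P: Pp => up _ /eqP<- _ _; apply/connectP; exists p.
Qed.

(** The endvertex condition of [Dpath] holds for the paths that lead from
    outside [D] into [D]. *)
Lemma card_ends D u v : u \notin D -> v \in D -> #|[set u; v] :&: D| = 1.
Proof.
move=> uND vD; rewrite -(cards1 v); apply: eq_card => w; rewrite !inE.
have [->|_] /= := eqVneq w u; last by case: eqP => // ->.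
by rewrite (negPf uND); apply/esym; apply: contraNF uND => /eqP->.
Qed.

Lemma dominates_half_pow D u v :
  u \notin D -> v \in D -> dominates v u -> (1 <= half_pow (distD D u v))%R.
Proof.
move=> uND vD /predU1P[def_u|uv]; first by rewrite def_u vD in uND.
have neq_uv : u != v by apply: contraTneq uv => ->; rewrite adj_irr.
suff /Dpath_weight : Dpath D u v [:: v] by [].
rewrite /Dpath /= uv inE neq_uv eqxx /= andbT.
by rewrite card_ends.
Qed.

Lemma dominates_weight D u v : v \in D -> dominates v u -> (1 <= weight D u)%R.
Proof.
have half_pow_le w : w \in D -> (half_pow (distD D u w) <= weight D u)%R.
  move=> wD; rewrite /weight (bigD1 w) //= lerDl sumr_ge0 // => x _.
  exact: half_pow_ge0.
move=> vD vu; have [uD|uND] := boolP (u \in D).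
  apply: le_trans (half_pow_le u uD); rewrite (distD_self uD).
  by apply: le_trans (half_pow_anti (isT : 0 <= 1)).
by apply: le_trans (half_pow_le v vD); apply: dominates_half_pow.
Qed.

Lemma dominating_exp_dominating D : dominating D -> exp_dominating D.
Proof.
move/dominatingP=> domD; apply/forallP=> u.
by have [v vD vu] := domD u; apply: dominates_weight vu.
Qed.

Lemma gamma_e_le_gamma : gamma_e G <= gamma G.
Proof.
have [D domD <-] := gamma_witness.
exact/gamma_e_min/dominating_exp_dominating.
Qed.

Lemma distance2_half_pow D u m v : u \notin D -> m \notin D -> v \in D ->
  adj u m -> adj m v -> (1 / 2 <= half_pow (distD D u v))%R.
Proof.
move=> uND mND vD um mv.
have neq_uv : u != v by apply: contraNneq uND => ->.
have neq_um : u != m by apply: contraTneq um => ->; rewrite adj_irr.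
have neq_mv : m != v by apply: contraTneq mv => ->; rewrite adj_irr.
suff /Dpath_weight : Dpath D u v [:: m; v] by [].
rewrite /Dpath /= um mv !inE negb_or neq_um neq_uv neq_mv eqxx mND /= !andbT.
by rewrite card_ends.
Qed.

(** For [u] outside both closed neighbourhoods, a common neighbour of [u] with
    [a] cannot be [a] or [b], so that the two paths of length 2 avoid the set
    inside, and each contributes 1/2. *)
Lemma exp_dominating_pair a b : a != b ->
    (forall u, [\/ dominates a u, dominates b u |
      exists m n, [/\ adj u m, adj m a, adj u n & adj n b]]) ->
  exp_dominating [set a; b].
Proof.
move=> neq_ab cover; apply/forallP=> u; have [aD bD] := (set21 a b, set22 a b).
have [au|Nau] := boolP (dominates a u); first exact: dominates_weight au.
have [bu|Nbu] := boolP (dominates b u); first exact: dominates_weight bu.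
have [|/(negP Nbu)//|[m [n [um ma un nb]]]] := cover u.
  by rewrite (negPf Nau).
have /norP[uNa Nadj_ua] := Nau; have /norP[uNb Nadj_ub] := Nbu.
have nbrND x : adj u x -> x \notin [set a; b].
  by move=> ux; rewrite !inE; apply/norP; split;
    [apply: contraNneq Nadj_ua | apply: contraNneq Nadj_ub] => <-.
have uND : u \notin [set a; b] by rewrite !inE negb_or uNa.
rewrite /weight big_setU1 ?inE //= big_set1.
have -> : 1%R = (1 / 2 + 1 / 2)%R :> rat by [].
apply: lerD.
  exact: (distance2_half_pow uND (nbrND m um) aD um ma).
exact: (distance2_half_pow uND (nbrND n un) bD un nb).
Qed.

End Domination.

(** * Graphs in which the two parameters differ *)

(** The vertices [x], [y], [z] force three dominators, whereas [a] and [b]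
    suffice for exponential domination. *)
Definition gap_witness (G : sgraph) (x y z a b : G) : Prop :=
  (forall u : G, [/\ ~~ (dominates u x && dominates u y),
     ~~ (dominates u y && dominates u z) & ~~ (dominates u z && dominates u x)])
  /\ (a != b /\
  (forall u, [\/ dominates a u, dominates b u |
      exists m n, [/\ adj u m, adj m a, adj u n & adj n b]])).

Lemma gap_witness_lt (G : sgraph) (x y z a b : G) :
  gap_witness x y z a b -> gamma_e G < gamma G.
Proof.
case=> far [neq_ab cover].
have /gamma_e_min := exp_dominating_pair neq_ab cover.
rewrite cards2 neq_ab /= => /leq_ltn_trans; apply.
have [D /dominatingP domD <-] := gamma_witness G.
have [x' x'D x'x] := domD x; have [y' y'D y'y] := domD y.
have [z' z'D z'z] := domD z.
apply/card_gt2P; exists x', y', z'; split=> //; split.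
- by apply: contraTneq x'x => ->; have [+ _ _] := far y'; rewrite y'y andbT.
- by apply: contraTneq y'y => ->; have [_ + _] := far z'; rewrite z'z andbT.
by apply: contraTneq z'z => ->; have [_ _ +] := far x'; rewrite x'x andbT.
Qed.

Lemma gap_witness_iso (G H : sgraph) (x y z a b : H) :
  isomorphic G H -> gap_witness x y z a b -> gamma_e G < gamma G.
Proof.
case=> f [g fK gK] f_adj [far [neq_ab cover]].
have g_adj u v : adj (g u) (g v) = adj u v by rewrite -f_adj !gK.
have g_dom u v : dominates (g u) (g v) = dominates u v.
  by rewrite /dominates (can_eq gK) g_adj.
apply: (@gap_witness_lt G (g x) (g y) (g z) (g a) (g b)).
split=> [u|]; first by rewrite -[u]fK !g_dom; apply: far.
split=> [|u]; first by rewrite (can_eq gK).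
rewrite -[u]fK !g_dom.
case: (cover (f u)) => [|| [m [n mn]]]; try by constructor.
by constructor 3; exists (g m), (g n); rewrite !g_adj.
Qed.

Lemma gap_P7 : @gap_witness P7
  (@Ordinal 7 0 isT) (@Ordinal 7 3 isT) (@Ordinal 7 6 isT)
  (@Ordinal 7 1 isT) (@Ordinal 7 5 isT).
Proof.
split=> [[i lt_i]|].
  rewrite /dominates /= /edge_list_adj /=.
  by do 7?[case: i lt_i => [|i] lt_i //].
split=> // -[i lt_i]; do 7?[case: i lt_i => [|i] lt_i //].
all: try by [constructor 1 | constructor 2].
by constructor 3; exists (@Ordinal 7 2 isT), (@Ordinal 7 4 isT).
Qed.

Lemma gap_F1 : @gap_witness F1
  (@Ordinal 6 3 isT) (@Ordinal 6 4 isT) (@Ordinal 6 5 isT)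
  (@Ordinal 6 0 isT) (@Ordinal 6 2 isT).
Proof.
split=> [[i lt_i]|].
  rewrite /dominates /= /edge_list_adj /=.
  by do 6?[case: i lt_i => [|i] lt_i //].
split=> // -[i lt_i]; do 6?[case: i lt_i => [|i] lt_i //].
all: try by [constructor 1 | constructor 2].
by constructor 3; exists (@Ordinal 6 1 isT), (@Ordinal 6 1 isT).
Qed.

Lemma connected_P7 : connected P7.
Proof.
apply: (@connected_from P7 (@Ordinal 7 0 isT)) => -[i lt_i].
elim: i lt_i => [|i IHi] lt_i; first exact: eq_connect0 (val_inj _).
apply: connect_trans (IHi (ltnW lt_i)) (connect1 _).
by move: lt_i => {IHi} lt_i; do 6?[case: i lt_i => [|i] lt_i //].
Qed.

Lemma connected_F1 : connected F1.
Proof.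
apply: (@connected_from F1 (@Ordinal 6 1 isT)) => -[i lt_i].
do 6?[case: i lt_i => [|i] lt_i //]; try by apply: connect1.
- exact: eq_connect0 (val_inj _).
- by apply: (@connect_trans _ _ (@Ordinal 6 0 isT)); apply: connect1.
by apply: (@connect_trans _ _ (@Ordinal 6 2 isT)); apply: connect1.
Qed.

(** * Forests without a copy of P7 or F1 *)

Section TwoVertices.
Variables (G : sgraph) (r : G).
Hypotheses (acG : acyclic G) (noP7 : ~ has_copy P7 G) (noF1 : ~ has_copy F1 G).
Implicit Types (s p : seq G) (u w x y : G).

(** The condition on [connect] confines the path to the component of [r]. *)
Definition path_near s : bool :=
  [&& sorted (@adj G) s, uniq s & all (connect (@adj G) r) s].

Definition longest s : Prop :=
  path_near s /\ forall s', path_near s' -> size s' <= size s.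

Lemma longest_exists : exists s, longest s.
Proof.
pose P n := [exists t : n.-tuple G, path_near t].
have P1 : exists n, P n.
  by exists 1; apply/existsP; exists [tuple r]; rewrite /path_near /= connect0.
have P_ub n : P n -> n <= #|G|.
  case/existsP=> t /and3P[_ t_uniq _]; rewrite -(size_tuple t).
  by rewrite -(card_uniqP t_uniq) max_card.
have [n /existsP[t t_path] max_n] := ex_maxnP P1 P_ub.
exists t; split=> // s s_path; rewrite size_tuple; apply: max_n.
by apply/existsP; exists (in_tuple s).
Qed.

Lemma longest_rev s : longest s -> longest (rev s).
Proof.
move=> [/and3P[sP sU sC] max_s]; split=> [|s' /max_s]; last by rewrite size_rev.
rewrite /path_near rev_sorted rev_uniq all_rev sU sC !andbT.
by rewrite (eq_sorted (e' := @adj G)) // => x y; rewrite adj_sym.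
Qed.

(** A neighbour of the first vertex off the path would extend it, and one on the
    path is the next vertex, since the path has no chord. *)
Lemma longest_end x p w : longest (x :: p) -> adj x w -> ohead p = Some w.
Proof.
move=> [/and3P[xP xU xC] max_xp] xw.
have [w_p | wNp] := boolP (w \in p); first exact: acyclic_chordless xw.
have : path_near [:: w, x & p]; last by move/max_xp; rewrite ltnn.
case/andP: (xC) => rx _; rewrite /path_near /= adj_sym xw.
move: xP xU xC => /= -> -> ->.
have neq_wx : w != x by apply: contraTneq xw => ->; rewrite adj_irr.
by rewrite inE negb_or neq_wx wNp (connect_trans rx (connect1 xw)).
Qed.

(** If [u] is off the path, replacing [x] by [u] gives another longest path, to
    which [longest_end] applies; otherwise [u] comes right after [y]. *)
Lemma longest_second x y p u w : longest [:: x, y & p] ->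
  adj y u -> adj u w -> w = y \/ ohead p = Some u.
Proof.
move=> lg_p yu uw.
have [/and3P[/= /andP[xy yP] /andP[xU yU] /and3P[_ ry pC]] _] := lg_p.
have [u_p | uNp] := boolP (u \in p).
  by right; apply: acyclic_chordless yu.
left; have neq_uy : u != y by apply: contraTneq yu => ->; rewrite adj_irr.
suff /longest_end/(_ uw)/= [->] : longest [:: u, y & p] by [].
split; last by case: lg_p.
rewrite /path_near /= adj_sym yu yP inE negb_or neq_uy uNp yU.
by rewrite (connect_trans ry (connect1 yu)) ry pC.
Qed.

Lemma longest_size s : path_near s -> size s <= 6.
Proof.
case: s => [|v0 [|v1 [|v2 [|v3 [|v4 [|v5 [|v6 s]]]]]]] // /and3P[sP sU _].
case: noP7.
apply: (@copy_of_edge_list G v0 [:: v0; v1; v2; v3; v4; v5; v6]) => //.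
  by move: sU; rewrite -[_ :: _](cat_take_drop 7) cat_uniq /= take0 => /andP[].
by move: sP => /= /and5P[-> -> -> -> /and3P[-> -> _]].
Qed.

(** The second vertex of [s] and that of [rev s] dominate together all vertices
    at distance 2 from the first of them.  The only critical vertices are those
    adjacent to the third vertex [u] of the path, when the path has five or six
    vertices: such a vertex either is next to [u] on the path or completes a
    copy of [F1] with central path [y; u; v3].  The default value [r] of [nth]
    covers the path with the single vertex [r]. *)
Lemma second_closed s u w : longest s ->
  adj (nth r s 1) u -> adj u w ->
  dominates (nth r s 1) w || dominates (nth r (rev s) 1) w.
Proof.
move=> lg_s; have [s_path max_s] := lg_s.
case: s lg_s s_path max_s => [|x [|y p]] lg_s s_path max_s.
- move=> ru _; have := max_s [:: r]; rewrite /path_near /= connect0.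
  by move/(_ isT).
- move=> /= ru _; have := max_s [:: r; u].
  rewrite /path_near /= ru connect0 connect1 //.
  rewrite inE andbT; case: eqVneq => [def_u|_ /(_ isT)] //.
  by rewrite -def_u adj_irr in ru.
move=> /= yu uw; have [->|] := longest_second lg_s yu uw.
  by rewrite /dominates eqxx.
case: p lg_s s_path {max_s} => [|v2 p] //= + + [def_u]; rewrite {v2}def_u.
case: p => [|v3 [|v4 p]] lg_s s_path; have := longest_rev lg_s; rewrite /rev /=.
- by move=> /longest_end/(_ uw)/= [->]; rewrite /dominates eqxx.
- by move=> _; rewrite /dominates [adj w u]adj_sym uw !orbT.
(* The path has at least five vertices: [x; y; u; v3; v4] and those of [p]. *)
move=> _; have p_size : size p <= 1 by have := longest_size s_path.
have /and3P[/= /and5P[xy yu' u3 v34 pP] sU _] := s_path.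
have left_path : path (@adj G) u [:: y; x].
  by rewrite /= [adj u y]adj_sym yu [adj y x]adj_sym xy.
have left_uniq : uniq [:: u; y; x].
  have : uniq ([:: x; y; u] ++ [:: v3, v4 & p]) by [].
  by rewrite cat_uniq -rev_uniq => /andP[].
have right_path : path (@adj G) u [:: v3, v4 & p] by rewrite /= u3 v34.
have right_uniq : uniq [:: u, v3, v4 & p] by case/and3P: sU.
have [wl|wNl] := boolP (w \in [:: y; x]).
  have [<-] := acyclic_chordless acG left_path left_uniq wl uw.
  by rewrite /dominates eqxx.
have [wr|wNr] := boolP (w \in [:: v3, v4 & p]).
  have [<-] := acyclic_chordless acG right_path right_uniq wr uw.
  rewrite /dominates.
  case: p p_size {lg_s s_path pP sU right_path right_uniq wr}.
    by rewrite /= eqxx orbT.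
  by move=> v5 [] //= _; rewrite v34 !orbT.
case: noF1; apply: (@copy_of_edge_list G x [:: y; u; v3; x; w; v4]) => //.
  have neq_uw : u != w by apply: contraTneq uw => ->; rewrite adj_irr.
  have core_uniq : uniq [:: x; y; u; v3; v4].
    have : uniq ([:: x; y; u; v3; v4] ++ p) by [].
    by rewrite cat_uniq => /andP[].
  have : uniq [:: w; x; y; u; v3; v4].
    rewrite cons_uniq core_uniq andbT; move: wNl wNr; rewrite !inE !negb_or.
    by rewrite [w == u]eq_sym neq_uw => /andP[-> ->] /and3P[-> -> _].
  rewrite (@perm_uniq _ _ [:: y; u; v3; x; w; v4]) //.
  by apply/permP=> a /=; rewrite !addnA [LHS](addn.[ACl 3*4*5*2*1*6*7]).
by rewrite /= yu u3 [adj y x]adj_sym xy uw v34.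
Qed.

(** The closed neighbourhood of the two second vertices is closed under
    adjacency, by [second_closed] for the longest path and its reverse. *)
Lemma two_vertices_dominate : exists2 A : {set G}, #|A| <= 2 &
  forall u, connect (@adj G) r u -> exists2 v, v \in A & dominates v u.
Proof.
have [s lg_s] := longest_exists.
pose a := nth r s 1; pose b := nth r (rev s) 1.
pose N := [pred u | dominates a u || dominates b u].
have closedN : closed (@adj G) N.
  apply: intro_closed => [|u w uw]; first exact: (sym_connect_sym (@adj_sym G)).
  rewrite !inE => /orP[] /predU1P[def_u|ua].
  - by rewrite /dominates [adj w a]adj_sym -def_u uw orbT.
  - by apply: second_closed uw; rewrite // adj_sym.
  - by rewrite /dominates [adj w b]adj_sym -def_u uw !orbT.
  have := second_closed (longest_rev lg_s) _ uw; rewrite revK orbC; apply.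
  by rewrite adj_sym.
have ra : connect (@adj G) r a.
  have [/and3P[_ _ /allP rs] _] := lg_s; rewrite /a.
  by have [/(mem_nth r)/rs|/(nth_default r)->] := ltnP 1 (size s).
exists [set a; b] => [|u ru]; first by rewrite cards2; case: (a != b).
have : u \in N.
  rewrite -(closed_connect closedN ru) (closed_connect closedN ra).
  by rewrite inE /dominates eqxx.
by case/orP; [exists a | exists b]; rewrite ?set21 ?set22.
Qed.

(** A component with at least two vertices of [D] has room for a dominating
    pair; a component with one is dominated by it, as nothing else contributes
    to the weights there; and [D] meets every component, as weights are
    positive. *)
Lemma component_domination D : exp_dominating D ->
  exists2 A : {set G}, #|A| <= #|D :&: [set v | connect (@adj G) r v]| &
  forall u, connect (@adj G) r u -> exists2 v, v \in A & dominates v u.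
Proof.
move=> /forallP expD; set C := [set v | _].
have [gt1|le1] := ltnP 1 #|D :&: C|.
  have [A A_le A_dom] := two_vertices_dominate.
  by exists A; first exact: leq_trans gt1.
exists (D :&: C) => // u ru.
have := expD u; rewrite /weight (big_setID C) /=.
rewrite [X in (_ + X)%R]big1 ?addr0; last first.
  move=> v; rewrite !inE => /andP[rv _]; apply: half_pow_dist_connect.
  by apply: contra rv => /(connect_trans ru).
move: le1; rewrite leq_eqVlt ltnS leqn0 cards_eq0.
case/orP=> [/cards1P[v ->]|/eqP->].
  by rewrite big_set1 => /half_pow_dist_dominates; exists v; rewrite ?set11.
by rewrite big_set0.
Qed.

End TwoVertices.

(** The roots of [fingraph] index the components, so that the choices made in
    [component_domination] can be united and counted. *)
Lemma gamma_le_gamma_e (G : sgraph) : acyclic G ->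
  ~ has_copy P7 G -> ~ has_copy F1 G -> gamma G <= gamma_e G.
Proof.
move=> acG noP7 noF1; have [D expD <-] := gamma_e_witness G.
have sym_conn := sym_connect_sym (@adj_sym G).
set e := @adj G in sym_conn *; have [A A_le A_dom] :=
  fin_all_exists2 (fun r => component_domination r acG noP7 noF1 expD).
pose B := \bigcup_(r | r \in roots e) A r.
apply: (@leq_trans #|B|).
  apply/gamma_min/dominatingP=> u.
  have [|v v_A vu] := A_dom (fingraph.root e u) u.
    by rewrite sym_conn connect_root.
  exists v => //; apply/bigcupP; exists (fingraph.root e u) => //.
  exact: roots_root.
have -> : #|D| = \sum_(r in roots e) #|D :&: [set v | connect e r v]|.
  rewrite -sum1_card.
  rewrite (partition_big (fingraph.root e) (mem (roots e))) /=; last first.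
    by move=> v _; apply: roots_root.
  apply: eq_bigr => r /eqP root_r; rewrite -sum1_card; apply: eq_bigl => v.
  by rewrite !inE -(root_connect sym_conn) root_r eq_sym.
rewrite /B; elim/big_rec2: _ => [|r n X _ le_Xn]; first by rewrite cards0.
by apply: leq_trans (leq_card_setU _ _) _; apply: leq_add.
Qed.

Theorem corollary3 (T : sgraph) (hT : is_tree T) :
  (forall S : {set T}, gamma (induced S) = gamma_e (induced S)) <->
  free_of (fun H => H = P7 \/ H = F1) T.
Proof.
have [_ acT] := hT.
split=> [eq_gamma H def_H S isoS | freeT S].
  have : gamma_e (induced S) < gamma (induced S).
    case: def_H isoS => -> isoS; first exact: gap_witness_iso isoS gap_P7.
    exact: gap_witness_iso isoS gap_F1.
  by rewrite eq_gamma ltnn.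
apply/eqP; rewrite eqn_leq gamma_e_le_gamma andbT.
apply: gamma_le_gamma_e; first exact: acyclic_induced.
  by move/has_copy_induced; apply: no_copy acT connected_P7 _ freeT; left.
by move/has_copy_induced; apply: no_copy acT connected_F1 _ freeT; right.
Qed.
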